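(* For every integer $m\geq 2$ and every integer $n\geq 2$ of the form $n=m-1+mt$ for some odd integer $t$, there is a subgroup of index $m$ in the group $\Gamma_n=\langle a,b : ba^nb=a\rangle$ which admits a positive cone of rank $m+1$.
   Context: A positive cone of a group $G$ is a subset $P\subseteq G$ such that $PP\subseteq P$ and $G=P\sqcup P^{-1}\sqcup\{1\}$ (disjoint union). The rank of a finitely generated semigroup is the smallest cardinality of a set generating it as a semigroup; the rank of a positive cone is its rank as a semigroup. *)

(* Defs.v *)
(* MathComp and mathcomp-classical. *)
From HB Require Import structures.
From mathcomp Require Import all_boot all_order all_algebra.
From mathcomp Require Import boolp classical_sets functions cardinality.

Set Implicit Arguments.
Unset Strict Implicit.
Unset Printing Implicit Defensive.

Local Open Scope classical_set_scope.
Local Open Scope card_scope.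
Local Open Scope group_scope.
Local Open Scope quotient_scope.

Section Presentation.
Variable X : choiceType.

(* The letter (x, false) stands for the generator x, and (x, true) for its
   formal inverse. *)
Definition word := seq (X * bool).

Definition inv_word (w : word) : word := rev [seq (l.1, ~~ l.2) | l <- w].

Variable R : word -> word -> Prop.

(* The smallest congruence on words which contains the relations R and the
   cancellations x x^-1 = x^-1 x = 1. *)
Inductive word_cong : word -> word -> Prop :=
| wc_refl u : word_cong u u
| wc_sym u v : word_cong u v -> word_cong v u
| wc_trans u v w : word_cong u v -> word_cong v w -> word_cong u w
| wc_cat u u' v v' :
    word_cong u u' -> word_cong v v' -> word_cong (u ++ v) (u' ++ v')
| wc_cancel x e : word_cong [:: (x, e); (x, ~~ e)] [::]
| wc_rel u v : R u v -> word_cong u v.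

Definition word_congb (u v : word) : bool := `[< word_cong u v >].

Lemma word_congb_refl : reflexive word_congb.
Proof. by move=> u; apply/asboolP/wc_refl. Qed.

Lemma word_congb_sym : symmetric word_congb.
Proof. by move=> u v; apply/asboolP/asboolP; apply: wc_sym. Qed.

Lemma word_congb_trans : transitive word_congb.
Proof.
by move=> v u w /asboolP uv /asboolP vw; apply/asboolP/(wc_trans uv vw).
Qed.

Canonical word_cong_equiv :=
  EquivRel word_congb word_congb_refl word_congb_sym word_congb_trans.

(* The group with generators X and defining relations u = v for R u v. *)
Definition presented_group : Type := {eq_quot word_congb}.

HB.instance Definition _ := Choice.on presented_group.
HB.instance Definition _ := EqQuotient.on presented_group.

Definition pres_class (w : word) : presented_group := \pi w.

Lemma pres_classP (u v : word) :
  pres_class u = pres_class v <-> word_cong u v.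
Proof.
rewrite /pres_class; split; first by move=> /eqmodP/asboolP.
by move=> uv; apply/eqmodP/asboolP.
Qed.

Definition pres_repr (x : presented_group) : word := repr x.

Lemma pres_reprK : cancel pres_repr pres_class.
Proof. exact: reprK. Qed.

Lemma pres_class_reprK (w : word) : word_cong (pres_repr (pres_class w)) w.
Proof. by apply/pres_classP; rewrite pres_reprK. Qed.

Lemma inv_word_cat (u v : word) : inv_word (u ++ v) = inv_word v ++ inv_word u.
Proof. by rewrite /inv_word map_cat rev_cat. Qed.

Lemma inv_wordK : involutive inv_word.
Proof.
move=> w; rewrite /inv_word map_rev revK -map_comp map_id_in // => -[x e] _ /=.
by rewrite negbK.
Qed.

Lemma word_cong_mulV (w : word) : word_cong (w ++ inv_word w) [::].
Proof.
elim/last_ind: w => [|w [x e] IHw]; first exact: wc_refl.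
rewrite -cats1 inv_word_cat -catA; apply: wc_trans IHw.
apply: wc_cat; first exact: wc_refl.
exact: (wc_cat (wc_cancel x e) (wc_refl (inv_word w))).
Qed.

Lemma word_cong_Vmul (w : word) : word_cong (inv_word w ++ w) [::].
Proof. by have := word_cong_mulV (inv_word w); rewrite inv_wordK. Qed.

Lemma word_cong_inv (u v : word) :
  word_cong u v -> word_cong (inv_word u) (inv_word v).
Proof.
move=> uv; apply: (@wc_trans _ (inv_word u ++ (v ++ inv_word v))).
  rewrite -{1}[inv_word u]cats0; apply: wc_cat; first exact: wc_refl.
  exact/wc_sym/word_cong_mulV.
rewrite catA -{2}[inv_word v]cat0s; apply: wc_cat; last exact: wc_refl.
apply: wc_trans (word_cong_Vmul u).
by apply: wc_cat; [exact: wc_refl | exact: wc_sym].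
Qed.

Definition pres_mul (x y : presented_group) : presented_group :=
  pres_class (pres_repr x ++ pres_repr y).
Definition pres_one : presented_group := pres_class [::].
Definition pres_inv (x : presented_group) : presented_group :=
  pres_class (inv_word (pres_repr x)).

Lemma pres_mulE (u v : word) :
  pres_mul (pres_class u) (pres_class v) = pres_class (u ++ v).
Proof. by apply/pres_classP; apply: wc_cat; apply: pres_class_reprK. Qed.

Lemma pres_invE (u : word) : pres_inv (pres_class u) = pres_class (inv_word u).
Proof. by apply/pres_classP; apply: word_cong_inv; apply: pres_class_reprK. Qed.

Lemma pres_mulA : associative pres_mul.
Proof.
move=> x y z; rewrite -[x]pres_reprK -[y]pres_reprK -[z]pres_reprK.
by rewrite !pres_mulE catA.
Qed.

Lemma pres_mul1 : left_id pres_one pres_mul.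
Proof. by move=> x; rewrite -[x]pres_reprK pres_mulE. Qed.

Lemma pres_mulr1 : right_id pres_one pres_mul.
Proof. by move=> x; rewrite -[x]pres_reprK pres_mulE cats0. Qed.

Lemma pres_mulV : left_inverse pres_one pres_inv pres_mul.
Proof.
move=> x; rewrite -[x]pres_reprK pres_invE pres_mulE.
exact/pres_classP/word_cong_Vmul.
Qed.

Lemma pres_mulrV : right_inverse pres_one pres_inv pres_mul.
Proof.
move=> x; rewrite -[x]pres_reprK pres_invE pres_mulE.
exact/pres_classP/word_cong_mulV.
Qed.

HB.instance Definition _ := isGroup.Build presented_group
  pres_mulA pres_mul1 pres_mulr1 pres_mulV pres_mulrV.

Definition pres_gen (x : X) : presented_group := pres_class [:: (x, false)].

End Presentation.

Section Gamma.

Definition letter_a : bool * bool := (false, false).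
Definition letter_b : bool * bool := (true, false).

Variable n : nat.

Definition Gamma_rel (u v : word bool) : Prop :=
  u = letter_b :: nseq n letter_a ++ [:: letter_b] /\ v = [:: letter_a].

(* < a, b : b a^n b = a > *)
Definition Gamma : groupType := presented_group Gamma_rel.

Definition Gamma_a : Gamma := pres_gen Gamma_rel false.
Definition Gamma_b : Gamma := pres_gen Gamma_rel true.

Lemma Gamma_relation : Gamma_b * Gamma_a ^+ n * Gamma_b = Gamma_a.
Proof.
have -> : Gamma_a ^+ n = pres_class Gamma_rel (nseq n letter_a) :> Gamma.
  elim: n => [//|k IHk]; rewrite expgS IHk.
  exact: (pres_mulE Gamma_rel [:: letter_a] (nseq k letter_a)).
rewrite [LHS](congr1 (fun x => pres_mul x _) (pres_mulE _ _ _)).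
rewrite pres_mulE -catA; apply/pres_classP/wc_rel; by split.
Qed.

End Gamma.

Section Cones.
Variable G : groupType.
Implicit Types H P S : set G.

Definition left_cosets H : set (set G) :=
  [set [set x * h | h in H] | x in [set: G]].

Definition has_index H (m : nat) : Prop := left_cosets H #= `I_m.

(* P is a positive cone of the group H, where H is a subgroup of G. *)
Definition positive_cone H P : Prop :=
  let Pinv := [set x^-1 | x in P] in
  [/\ P `<=` H,
      mulg_closed [in P],
      H = P `|` Pinv `|` [set 1]
    & [/\ P `&` Pinv = set0, P `&` [set 1] = set0 & Pinv `&` [set 1] = set0]].

Definition semigroup_gen S : set G :=
  smallest (fun M : set G => mulg_closed [in M]) S.

Definition semigroup_rank P (r : nat) : Prop :=
  (exists2 S : set G, S #= `I_r & semigroup_gen S = P) /\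
  (forall S : set G, semigroup_gen S = P -> `I_r #<= S).

End Cones.

(* Main.v *)
Require Import Defs.
From mathcomp Require Import all_boot all_order all_algebra.
From mathcomp Require Import boolp classical_sets functions cardinality.
From mathcomp Require Import zify.

(** Put c = b a^n. The relation b a^n b = a says c^2 = a^(n+1), so Gamma_n is
    < a, c : c^2 = a^(n+1) > with b = c^-1 a, and a^(n+1) is central.

    The semigroup generated by a and b is a positive cone of Gamma_n. Every
    positive word has a normal form a^N b a^i1 ... b a^ik where each i_j is
    less than n, except for the last one, which may be n ([nf_exists]). If
    N = 0 such a word divides a on the left, and otherwise a divides it; so
    any two positive elements can be cancelled against one another and every
    element is positive or the inverse of a positive one ([ev_or_inv]). In the
    free product Z/(n+1) * Z/2 = Gamma_n / < a^(n+1) > the normal form is a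
    reduced word with k letters c, so it can be trivial only when k = 0, and a
    has infinite order: no nonempty positive word is trivial ([ev_eq1]).

    Since n = m - 1 + m t with t odd, 2m divides n + 1, and sending a and b to
    1 defines a homomorphism onto Z/m. The subgroup H is its kernel and P is
    the set of positive elements of H, that is, of the values of nonempty
    positive words whose length is a multiple of m.

    Upper bound: P is generated by the words of length m in a and b, and
    already by the m + 1 words a^i b^(m-i). Replacing the last letter a of a
    word u a b^j of length m by b a^n b gives
      u a b^j = (u b a^j) (a^m)^t (a^|u| b^(j+1)).
    Reading a as the digit 0 and b as the digit 1, the first block is the
    successor of u a b^j in binary, so descending induction from b^m shows
    that all words of length m are generated ([block_carry], [block_fill]).

    Lower bound: H is generated by a^m and the m elements a^i c a^-i, and its
    defining relations c_i^2 = (a^m)^((n+1)/m) vanish modulo 2 because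
    (n+1)/m is even; hence H maps onto (Z/2)^(m+1), and this is where t odd is
    used. The image of P spans that space, so a generating set of P has at
    least m + 1 elements ([nu_cone_span]). *)

Set Implicit Arguments.
Unset Strict Implicit.
Unset Printing Implicit Defensive.

(** * Positive words and their normal forms *)

Section PositiveWords.
Local Open Scope group_scope.
Variable n : nat.
Implicit Types (u v w : seq bool) (s : seq nat) (g h : Gamma n).

(** A list of booleans is a positive word: false stands for a, true for b. *)
Definition ev w : Gamma n :=
  pres_class (Gamma_rel n) [seq (x, false) | x <- w].

Lemma ev_cat u v : ev (u ++ v) = ev u * ev v.
Proof. by rewrite /ev map_cat; symmetry; apply: pres_mulE. Qed.

Lemma ev_nil : ev [::] = 1. Proof. by []. Qed.

Lemma ev_catl u v v' : ev v = ev v' -> ev (u ++ v) = ev (u ++ v').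
Proof. by rewrite !ev_cat => ->. Qed.

Lemma ev_catr u u' v : ev u = ev u' -> ev (u ++ v) = ev (u' ++ v).
Proof. by rewrite !ev_cat => ->. Qed.

Lemma ev_relation w :
  ev (true :: nseq n false ++ true :: w) = ev (false :: w).
Proof.
rewrite -[false :: w]/([:: false] ++ w).
rewrite -[true :: w]/([:: true] ++ w) catA -cat_cons.
apply: ev_catr; apply/pres_classP/wc_rel; split=> //.
by rewrite /= map_cat map_nseq.
Qed.

(** The relation is a palindrome, so reversal of words is an
    anti-automorphism of Gamma_n; it exchanges left and right divisibility. *)
Lemma ev_rev u v : ev u = ev v -> ev (rev u) = ev (rev v).
Proof.
move=> /pres_classP uv; apply/pres_classP; rewrite !map_rev.
elim: uv => {u v}.
- by move=> u; apply: wc_refl.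
- by move=> u v _ /wc_sym.
- by move=> u v w _ IHu _ IHv; apply: wc_trans IHv.
- by move=> u u' v v' _ IHu _ IHv; rewrite !rev_cat; apply: wc_cat.
- by move=> x e; rewrite -{1}[e]negbK; apply: wc_cancel.
- move=> _ _ [-> ->]; apply: wc_rel; split=> //.
  by rewrite rev_cons rev_cat rev_nseq -cats1.
Qed.

(** a^(n+1) is central: b a^n b a^n b can be shortened at either end, to
    a^(n+1) b or to b a^(n+1). *)
Lemma ev_central w :
  ev (true :: nseq n.+1 false ++ w) = ev (nseq n.+1 false ++ true :: w).
Proof.
rewrite [RHS]/(ev (false :: (nseq n false ++ true :: w))) -[RHS]ev_relation.
rewrite -addn1 nseqD -catA; apply: (@ev_catl (true :: nseq n false)).
by rewrite /= -ev_relation.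
Qed.

(** The exponents i1, ..., ik encode the word b a^i1 ... b a^ik. *)
Definition nf_tail s : seq bool := flatten [seq true :: nseq i false | i <- s].

Lemma nf_tail_cons i s :
  nf_tail (i :: s) = (true :: nseq i false) ++ nf_tail s.
Proof. by []. Qed.

(** Neither b a^n b nor a^(n+1) occurs in the word with these exponents. *)
Fixpoint reduced s : bool :=
  if s is i :: s' then (i + (s' != [::]) <= n) && reduced s' else true.

(** Multiplying a normal form by b on the left: powers a^(n+1) move to the
    front by centrality, and b a^n b, which can appear only at the front, is
    replaced by a. The bound on N' + size s' keeps track of nontriviality. *)
Lemma nf_cons N s (red_s : reduced s) :
  exists N' s', [/\ reduced s', 0 < N' + size s' &
    ev (true :: nseq N false ++ nf_tail s) = ev (nseq N' false ++ nf_tail s')].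
Proof.
have [k] := ubnP N; elim: k N => // k IHk N ltNk.
have [ltnN | leNn] := ltnP n N.
  have [|N' [s' [rs' _ eqs']]] := IHk (N - n.+1); first by lia.
  exists (n.+1 + N'), s'; split=> //.
  rewrite -(subnKC ltnN) nseqD -catA ev_central.
  by rewrite nseqD -catA; apply: ev_catl.
case: s red_s {IHk} => [|i s] /=.
  by move=> _; exists 0, [:: N]; rewrite /= addn0 leNn.
case/andP=> le_i red_s; have [eqN | neqN] := eqVneq N n.
  exists i.+1, s; split=> //; rewrite eqN ev_relation.
  by rewrite /nf_tail.
exists 0, [:: N, i & s]; split=> //=.
by rewrite le_i red_s !andbT addn1 ltn_neqAle neqN.
Qed.

Lemma nf_exists w : exists N s,
  [/\ reduced s, w != [::] -> 0 < N + size s &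
      ev w = ev (nseq N false ++ nf_tail s)].
Proof.
elim: w => [|x w [N [s [red_s _ eqw]]]]; first by exists 0, [::].
case: x.
  have [N' [s' [red_s' gt0 eqs']]] := nf_cons N red_s.
  exists N', s'; split=> //; rewrite -eqs'.
  exact: (@ev_catl [:: true]).
exists N.+1, s; split=> //; exact: (@ev_catl [:: false]).
Qed.

(** In a = b a^n b, cancel b a^i from the left. What remains is
    a a^(n-i-1) b, and by induction the rest of the word divides its first
    letter a; this is why interior exponents must be less than n. *)
Lemma reduced_dvd_a s : reduced s -> exists v, ev (nf_tail s ++ v) = ev [:: false].
Proof.
elim: s => [_|i s IHs]; first by exists [:: false].
rewrite [reduced _]/=; case: s IHs => [_|j s IHs] /andP[le_i].
  move=> _; exists (nseq (n - i) false ++ [:: true]).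
  rewrite addn0 in le_i.
  by rewrite nf_tail_cons cats0 /= catA -nseqD subnKC // ev_relation.
case/IHs=> v eqv; rewrite addn1 in le_i.
set c := nseq (n - i.+1) false ++ [:: true]; exists (v ++ c).
transitivity (ev (true :: nseq n false ++ [:: true])); last exact: ev_relation.
have -> : nseq n false = nseq i false ++ false :: nseq (n - i.+1) false.
  by rewrite -(nseqD i (n - i.+1).+1) -subSn // subSS subnKC // ltnW.
rewrite -[_ ++ [:: true]]catA nf_tail_cons -catA.
apply: (@ev_catl (true :: nseq i false)).
by rewrite catA; apply: (@ev_catr _ [:: false]).
Qed.

(** Left divisibility compares any positive word with a letter. The letter b
    needs no normal form, since b divides a. *)
Lemma dvd_total_letter x w :
  (exists v, ev w = ev (x :: v)) \/ (exists v, ev (w ++ v) = ev [:: x]).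
Proof.
case: x; last first.
  have [N [s [red_s _ eqw]]] := nf_exists w.
  case: N eqw => [|N] eqw.
    right; have [v eqv] := reduced_dvd_a red_s; exists v.
    by rewrite -eqv; apply: ev_catr.
  by left; exists (nseq N false ++ nf_tail s).
case: w => [|[] w]; [by right; exists [:: true] | by left; exists w |].
by left; exists (nseq n false ++ true :: w); rewrite ev_relation.
Qed.

(** Positive elements and their inverses form a set stable under left
    multiplication by a letter or its inverse: a cancellation is always
    decided by divisibility, on the left for [mulV] and, after reversal, on
    the right for [mulr]. *)
Lemma ev_or_inv g : exists w, g = ev w \/ g = (ev w)^-1.
Proof.
have mulV x w : exists v, (ev [:: x])^-1 * ev w = ev v \/
    (ev [:: x])^-1 * ev w = (ev v)^-1.
  have [[v ->]|[v eqv]] := dvd_total_letter x w.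
    by exists v; left; rewrite -(cat1s x v) ev_cat mulKg.
  by exists v; right; rewrite -eqv ev_cat invgM mulgVK.
have mulr x w : exists v, ev [:: x] * (ev w)^-1 = ev v \/
    ev [:: x] * (ev w)^-1 = (ev v)^-1.
  have [[v eqv]|[v eqv]] := dvd_total_letter x (rev w); move/ev_rev: eqv.
    rewrite revK rev_cons -cats1 => ->; exists (rev v); right.
    by rewrite ev_cat invgM mulVKg.
  rewrite rev_cat revK => <-; exists (rev v); left.
  by rewrite ev_cat mulgK.
rewrite -[g]pres_reprK; elim: (pres_repr g) => [|[x e] w [v IHv]].
  by exists [::]; left.
have -> : pres_class (Gamma_rel n) ((x, e) :: w) =
    (if e then (ev [:: x])^-1 else ev [:: x]) *
    (pres_class (Gamma_rel n) w : Gamma n).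
  rewrite -(cat1s (x, e)) -(pres_mulE (Gamma_rel n) [:: (x, e)] w).
  case: e => //; congr (_ * _).
  by rewrite -(pres_invE (Gamma_rel n) [:: (x, false)]).
case: e; case: IHv => ->.
- exact: mulV.
- by exists (v ++ [:: x]); right; rewrite ev_cat invgM.
- by exists (x :: v); left; rewrite -(cat1s x v) ev_cat.
- exact: mulr.
Qed.

End PositiveWords.

(** * Actions of the group *)

(** A right action of Gamma_n, given through the presentation
    < a, c : c^2 = a^(n+1) >: alpha is the action of a and gamma that of
    c = b a^n, so b = c^-1 a acts as gammaV followed by alpha. *)
Record Gamma_action (n : nat) (T : Type) := GammaAction {
  alpha : T -> T;
  alphaV : T -> T;
  gamma : T -> T;
  gammaV : T -> T;
  alphaK : cancel alpha alphaV;
  alphaVK : cancel alphaV alpha;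
  gammaK : cancel gamma gammaV;
  gammaVK : cancel gammaV gamma;
  gamma2 : forall t, gamma (gamma t) = iter n.+1 alpha t
}.

Section Actions.
Local Open Scope group_scope.
Variables (n : nat) (T : Type) (A : Gamma_action n T).
Implicit Types (t : T) (w : seq bool) (g h : Gamma n).

Definition act_letter t (l : bool * bool) : T :=
  match l with
  | (false, false) => alpha A t
  | (false, true) => alphaV A t
  | (true, false) => alpha A (gammaV A t)
  | (true, true) => gamma A (alphaV A t)
  end.

Definition act_word := foldl act_letter.

Definition act t g : T := act_word t (pres_repr g).

Definition act_pos t w : T :=
  foldl (fun t x => if x then alpha A (gammaV A t) else alpha A t) t w.

Lemma act_word_pos t w : act_word t [seq (x, false) | x <- w] = act_pos t w.
Proof. by elim: w t => [//|[] w IHw] t; rewrite /= IHw. Qed.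

Lemma act_pos_nseq t k : act_pos t (nseq k false) = iter k (alpha A) t.
Proof. by elim: k t => [//|k IHk] t; rewrite iterSr -IHk. Qed.

Lemma act_pos_cat t u w : act_pos t (u ++ w) = act_pos (act_pos t u) w.
Proof. exact: foldl_cat. Qed.

Lemma act_word_cong u v : word_cong (Gamma_rel n) u v ->
  forall t, act_word t u = act_word t v.
Proof.
elim=> {u v} //.
- by move=> u v w _ uv _ vw t; rewrite uv.
- move=> u u' v v' _ uu' _ vv' t.
  by rewrite /act_word !foldl_cat -!/(act_word _ _) uu' vv'.
- by case=> [] [] t; rewrite /act_word /= ?(alphaK, alphaVK, gammaK, gammaVK).
- move=> _ _ [-> ->] t.
  have -> : letter_b :: nseq n letter_a ++ [:: letter_b] =
      [seq (x, false) | x <- true :: nseq n false ++ [:: true]].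
    by rewrite /= map_cat map_nseq.
  rewrite act_word_pos /= act_pos_cat act_pos_nseq -iterSr.
  by rewrite -gamma2 /= gammaK gammaVK.
Qed.

Lemma act_class t (w : word bool) : act t (pres_class (Gamma_rel n) w) = act_word t w.
Proof. exact/act_word_cong/pres_class_reprK. Qed.

Lemma act_ev t w : act t (ev n w) = act_pos t w.
Proof. by rewrite act_class act_word_pos. Qed.

Lemma actM t g h : act t (g * h) = act (act t g) h.
Proof. by rewrite [LHS]act_class /act_word foldl_cat. Qed.

Lemma act1 t : act t 1 = t.
Proof. exact: act_class. Qed.

Lemma actVK t g : act (act t g^-1) g = t.
Proof. by rewrite -actM mulVg act1. Qed.

End Actions.

(** * Nontriviality of positive words *)

Section Degree.
Local Open Scope ring_scope.
Import GRing.Theory.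
Variable n : nat.

Lemma degree_gamma2 (z : int) :
  z + n.+1%:Z + n.+1%:Z = iter n.+1 (fun x => x + 2) z.
Proof.
have -> k : iter k (fun x : int => x + 2) z = z + 2 * k%:Z.
  by elim: k => [|k /= ->] /=; lia.
lia.
Qed.

(** The homomorphism to the integers sending a to 2 and c to n + 1, as an
    action by translations. *)
Definition degree_action : Gamma_action n int :=
  GammaAction (addrK 2) (subrK 2) (addrK n.+1%:Z) (subrK n.+1%:Z) degree_gamma2.

Lemma ev_nseq_a_eq1 N : ev n (nseq N false) = 1%g -> N = 0%N.
Proof.
move=> /(congr1 (act degree_action 0)); rewrite act1 act_ev act_pos_nseq /=.
have -> : iter N (fun x : int => x + 2) 0 = 2 * N%:Z.
  by elim: N => [|k /= ->] /=; lia.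
lia.
Qed.

End Degree.

(** The action of Gamma_n on the cosets of < c > in the free product
    Z/(n+1) * Z/2. The head is the current power of a, and the stack lists the
    earlier powers of a between letters c. Stack entries are nonzero residues,
    encoded by 'I_n through lift ord0. *)
Section Stack.
Variable n : nat.
Local Notation state := ('I_n.+1 * seq 'I_n)%type.
Implicit Types (x : state) (s : seq nat).

Definition rotate x : state := (ordS x.1, x.2).
Definition unrotate x : state := (ord_pred x.1, x.2).

Definition push_pop x : state :=
  match unlift ord0 x.1, x.2 with
  | Some j, st => (ord0, j :: st)
  | None, [::] => (ord0, [::])
  | None, j :: st => (lift ord0 j, st)
  end.

Lemma rotateK : cancel rotate unrotate.
Proof. by case=> h st; rewrite /unrotate /= ordSK. Qed.

Lemma unrotateK : cancel unrotate rotate.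
Proof. by case=> h st; rewrite /rotate /= ord_predK. Qed.

Lemma push_popK : involutive push_pop.
Proof.
case=> h st; rewrite /push_pop; case: (unliftP ord0 h) => [j|] -> /=.
  by rewrite unlift_none.
by case: st => [|j st] /=; rewrite ?unlift_none ?liftK.
Qed.

Lemma iter_rotate k x :
  (iter k rotate x).1 = (x.1 + k) %% n.+1 :> nat /\ (iter k rotate x).2 = x.2.
Proof.
elim: k => [|k [IH1 IH2]] /=; first by rewrite addn0 modn_small.
by rewrite IH2 IH1 -addn1 modnDml addn1 addnS.
Qed.

Lemma push_pop2 x : push_pop (push_pop x) = iter n.+1 rotate x.
Proof.
rewrite push_popK; have [] := iter_rotate n.+1 x.
case: x (iter _ _ _) => [h st] [h' st'] /= eq1 ->; congr (_, _).
by apply: val_inj; rewrite /= eq1 modnDr modn_small.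
Qed.

Definition stack_action : Gamma_action n state :=
  GammaAction rotateK unrotateK push_popK push_popK push_pop2.

(** Each letter b = c^-1 a first pushes the nonzero head; the exponent i + 1
    of the following power of a lies strictly between 0 and n + 1 unless it
    comes last, so the next letter c pushes again and never pops. *)
Lemma stack_growth s x : reduced n s -> x.1 != ord0 ->
  size (act_pos stack_action x (nf_tail s)).2 = size x.2 + size s.
Proof.
elim: s x => [|i s IHs] [h st]; first by rewrite addn0.
rewrite [reduced _ _]/=; case/andP=> le_i red_s; case: (unliftP ord0 h) => [j ->|-> //] _.
rewrite nf_tail_cons /= act_pos_cat act_pos_nseq -iterSr.
have -> : push_pop (lift ord0 j, st) = (ord0, j :: st).
  by rewrite /push_pop /= liftK.
rewrite [alpha _]/=; have [] := iter_rotate i.+1 (ord0, j :: st).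
set y := iter i.+1 _ _; rewrite add0n => y1 y2.
case: s IHs le_i red_s => [|k s] IHs le_i red_s; first by rewrite [LHS]/(size y.2) y2 addn1.
have y_neq0 : y.1 != ord0.
  by rewrite -val_eqE [val _]y1 modn_small // -addn1.
by rewrite IHs // y2 /= addSnnS.
Qed.

End Stack.

(** If a^N r = 1 then also r a^N = 1, and a^N leaves the stack size alone; so
    stack growth forces r to be empty, and a has infinite order. *)
Lemma ev_eq1 n w : 0 < n -> ev n w = 1%g -> w = [::].
Proof.
move=> n_gt0 ev1; have [N [s [red_s gt0 eqw]]] := nf_exists n w.
apply/eqP; apply: contraT => /gt0; rewrite lt0n.
suff s0 : s = [::].
  rewrite s0 cats0 ev1 in eqw; move/esym/ev_nseq_a_eq1: eqw => ->.
  by rewrite s0.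
have sN1 : ev n (nf_tail s ++ nseq N false) = 1%g.
  rewrite ev1 ev_cat in eqw; rewrite ev_cat.
  by rewrite -[RHS](mulVg (ev n (nseq N false))) -[in RHS](mulg1 (_^-1)%g) eqw !mulgA mulVg mul1g.
pose x0 : 'I_n.+1 * seq 'I_n := (lift ord0 (Ordinal n_gt0), [::]).
move: sN1 => /(congr1 (act (stack_action n) x0)).
rewrite act1 act_ev act_pos_cat act_pos_nseq => /(congr1 (fun x => size x.2)).
have [_ ->] := iter_rotate N (act_pos (stack_action n) x0 (nf_tail s)).
by rewrite stack_growth // => /size0nil.
Qed.

(** * Generating by blocks of length m *)

Section Blocks.
Local Open Scope group_scope.
Variables (n m t : nat) (M : Gamma n -> Prop).
Hypothesis n1E : n.+1 = (m * t.+1)%N.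
Hypothesis M_mul : forall g h, M g -> M h -> M (g * h).
Hypothesis M_gen :
  forall i, i <= m -> M (ev n (nseq i false ++ nseq (m - i) true)).
Implicit Types (u w : seq bool).

Lemma block_pad u c : M (ev n u) -> M (ev n (u ++ nseq (m * c)%N false)).
Proof.
move=> Mu; elim: c => [|c IHc]; first by rewrite muln0 cats0.
rewrite mulnS addnC nseqD catA ev_cat; apply: M_mul => //.
by have := M_gen (leqnn m); rewrite subnn cats0.
Qed.

(** Replace the last letter a by b a^n b and cut a^n into a^j (a^m)^t a^|u|. *)
Lemma block_carry u j : size u + j.+1 = m ->
  ev n (u ++ false :: nseq j true) =
  ev n ((u ++ true :: nseq j false) ++ nseq (m * t)%N false) *
  ev n (nseq (size u) false ++ nseq (m - size u) true).
Proof.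
move=> size_u; rewrite -ev_cat -!catA; apply: ev_catl.
rewrite -[LHS]ev_relation /= !catA -!nseqD.
rewrite (_ : (j + m * t + size u = n)%N); last by lia.
by rewrite (_ : m - size u = j.+1) //; lia.
Qed.

(** Descending induction on binary numbers, organised by the length j of the
    suffix: [Mub] treats the suffixes starting with b, and the carry then
    gives the block u a b^(j-1) from u b a^(j-1). *)
Lemma block_fill j u : size u + j = m -> M (ev n (u ++ nseq j true)) ->
  forall w, size w = j -> M (ev n (u ++ w)).
Proof.
elim: j u => [|j IHj] u size_u Mu w; first by move/size0nil->.
have Mub v : size v = j -> M (ev n (u ++ true :: v)).
  rewrite -cat1s catA => size_v; apply: IHj => //.
    by rewrite size_cat /= -addnA.
  by rewrite -catA.
case: w => [//|x w] [size_w]; case: x; first exact: Mub.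
rewrite -cat1s catA; apply: IHj => //.
  by rewrite size_cat /= -addnA.
rewrite -catA cat1s block_carry //; apply: M_mul.
  by apply/block_pad/Mub/size_nseq.
by apply: M_gen; rewrite -size_u leq_addr.
Qed.

Lemma block_words c w : size w = (m * c.+1)%N -> M (ev n w).
Proof.
elim: c w => [|c IHc] w size_w.
  rewrite muln1 in size_w; apply: (@block_fill m [::]) => //=.
  by have := M_gen (leq0n m); rewrite subn0.
rewrite -(cat_take_drop m w) ev_cat; apply: M_mul.
  apply: (@block_fill m [::]) => //=.
    by have := M_gen (leq0n m); rewrite subn0.
  by rewrite size_takel // size_w mulnS leq_addr.
by apply: IHc; rewrite size_drop size_w mulnS addKn.
Qed.

End Blocks.

(** * The subgroup of index m and its image in an elementary 2-group *)

(** Throughout m = p + 1. *)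
Section Stabilizer.
Local Open Scope classical_set_scope.
Local Open Scope ring_scope.
Import GRing.Theory.
Variables (n p : nat).
Hypothesis dvd_n1 : (2 * p.+1 %| n.+1)%N.
Local Notation vec := 'rV['F_2]_p.+2.
Local Notation state := ('I_p.+1 * vec)%type.
Implicit Types (v : vec) (x : 'I_p.+1) (i : 'I_p.+2) (g h : Gamma n).

Local Notation e_ i := (delta_mx 0 i : vec).

(** The Reidemeister-Schreier rewriting for H, read modulo 2. The first
    component is the current coset in Z/m; a moves to the next coset, counting
    a^m in coordinate 0 when it wraps around, and c stays in the coset x and
    counts the generator a^x c a^-x in coordinate x + 1. *)
Definition advance (y : state) : state :=
  (ordS y.1, y.2 + (ordS y.1 == ord0)%:R *: e_ ord0).

Definition retreat (y : state) : state :=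
  (ord_pred y.1, y.2 - (y.1 == ord0)%:R *: e_ ord0).

Definition record (y : state) : state := (y.1, y.2 + e_ (lift ord0 y.1)).

Lemma advanceK : cancel advance retreat.
Proof. by case=> x v; rewrite /retreat /= ordSK addrK. Qed.

Lemma retreatK : cancel retreat advance.
Proof. by case=> x v; rewrite /advance /= ord_predK subrK. Qed.

Lemma natr_F2 k : (2 * k)%:R = 0 :> 'F_2.
Proof. by rewrite natrM (_ : 2%:R = 0) ?mul0r //; apply: val_inj. Qed.

Lemma addvv v : v + v = 0.
Proof. by rewrite -mulr2n -scaler_nat (natr_F2 1) scale0r. Qed.

Lemma recordK : involutive record.
Proof. by case=> x v; rewrite /record /= -addrA addvv addr0. Qed.

Lemma iter_advance k (y : state) :
  val (iter k advance y).1 = ((y.1 + k) %% p.+1)%N /\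
  (iter k advance y).2 = y.2 + ((y.1 + k) %/ p.+1)%:R *: e_ ord0.
Proof.
elim: k => [|k [IH1 IH2]] /=.
  by rewrite addn0 modn_small // divn_small // scale0r addr0.
have eqS : (((y.1 + k) %% p.+1).+1 %% p.+1 = (y.1 + k.+1) %% p.+1)%N.
  by rewrite -addn1 modnDml addn1 addnS.
split; first by rewrite IH1.
rewrite IH2 -addrA -scalerDl addnS divnS // natrD.
congr (_ + _ *: _); rewrite addrC; congr (_%:R + _).
by rewrite -val_eqE /= IH1 eqS addnS.
Qed.

(** A factor m of n + 1 brings the coset back; the factor 2 makes the number of
    wraps even, so that c^2 = a^(n+1) acts trivially. *)
Lemma iter_advance_full (y : state) : iter n.+1 advance y = y.
Proof.
have [] := iter_advance n.+1 y; have [k {2 4}->] := dvdnP dvd_n1.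
rewrite mulnA addnC modnMDl modn_small // divnMDl // divn_small // addn0 mulnC.
rewrite natr_F2 scale0r addr0.
by case: y (iter _ _ _) => [x v] [x' v'] /= /val_inj-> ->.
Qed.

Lemma record2 (y : state) : record (record y) = iter n.+1 advance y.
Proof. by rewrite recordK iter_advance_full. Qed.

Definition schreier_action : Gamma_action n state :=
  GammaAction advanceK retreatK recordK recordK record2.

Local Notation "y ^@ g" := (act schreier_action y g) (at level 30).

(** The recorded vector never influences the motion, so translations commute
    with the action. *)
Lemma act_shift x v w g :
  (x, v + w) ^@ g = (((x, v) ^@ g).1, ((x, v) ^@ g).2 + w).
Proof.
rewrite /act; elim: (pres_repr g) x v => [//|l s IHs] x v.
rewrite /act_word /= -!/(act_word _ _ _).
have -> : act_letter schreier_action (x, v + w) l =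
    ((act_letter schreier_action (x, v) l).1,
     (act_letter schreier_action (x, v) l).2 + w).
  by case: l => [] [] [] /=; congr (_, _) => /=;
    rewrite -!addrA ?[w + _]addrC -?addrA ?[w + _]addrC.
by rewrite IHs -surjective_pairing.
Qed.

Definition base : state := (ord0, 0).

Definition stab : set (Gamma n) := [set g | (base ^@ g).1 = ord0].

(** On [stab] this is a homomorphism to the vector space ([nuM]). *)
Definition nu g : vec := (base ^@ g).2.

Lemma act_base g : stab g -> forall h,
  base ^@ (g * h)%g = ((base ^@ h).1, nu h + nu g).
Proof.
move=> gH h; rewrite actM [base ^@ g]surjective_pairing gH -/(nu g).
by rewrite -[X in (_, X)]add0r act_shift.
Qed.

Lemma nuM g h : stab g -> nu (g * h)%g = nu h + nu g.
Proof. by move=> gH; rewrite /nu act_base. Qed.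

Lemma stab1 : stab 1%g. Proof. by rewrite /stab /= act1. Qed.

Lemma stabM g h : stab g -> (stab (g * h)%g <-> stab h).
Proof. by move=> gH; rewrite /stab /= act_base. Qed.

Lemma stabV g : stab g -> stab (g^-1)%g.
Proof. by move=> gH; apply/(stabM _ gH); rewrite mulgV; exact: stab1. Qed.

Lemma stab_group : group_closed [in stab].
Proof.
split; first by rewrite inE; exact: stab1.
by move=> g h /[!inE] gH hH; apply/stabM/stabV.
Qed.

Lemma act_pos_fst (y : state) w :
  val (act_pos schreier_action y w).1 = ((y.1 + size w) %% p.+1)%N.
Proof.
elim: w y => [|x w IHw] y /=; first by rewrite addn0 modn_small.
by rewrite IHw; case: x; rewrite /= modnDml addSnnS.
Qed.

Lemma stab_ev w : stab (ev n w) <-> (p.+1 %| size w)%N.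
Proof.
rewrite /stab /= act_ev (rwP eqP) -val_eqE /= act_pos_fst add0n.
by rewrite /dvdn.
Qed.

Lemma act_fst (y y' : state) g : y.1 = y'.1 -> (y ^@ g).1 = (y' ^@ g).1.
Proof.
case: y y' => [x v] [_ v'] /= <-.
by rewrite -(add0r v) -(add0r v') !act_shift.
Qed.

(** The coset x H is determined by the image of the base coset under x^-1, and
    powers of a reach all m positions. *)
Lemma stab_index : has_index stab p.+1.
Proof.
pose coset k : set (Gamma n) := [set g | (base ^@ g^-1%g).1 = k :> nat].
pose pow (k : nat) : Gamma n := ((ev n (nseq k false))^-1)%g.
have pow_coset k : (k < p.+1)%N -> coset k (pow k).
  move=> ltk; rewrite /coset /pow /= invgK act_ev act_pos_fst size_nseq.
  by rewrite add0n modn_small.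
have cosetE (x : Gamma n) : [set (x * h)%g | h in stab] = coset (base ^@ x^-1%g).1.
  apply/seteqP; split=> [_ [h hH <-]|g /= gx].
    by rewrite /coset /= invgM act_base //; exact: stabV.
  exists (x^-1 * g)%g; last by rewrite mulVKg.
  rewrite -[X in stab X]invgK; apply: stabV.
  rewrite /stab /= invgM invgK actM (@act_fst _ (base ^@ x^-1%g)) ?actVK //.
  exact: val_inj.
rewrite /has_index; have -> : left_cosets stab = coset @` `I_p.+1.
  apply/seteqP; split=> [_ [x _ <-]|_ [k ltk <-]].
    by rewrite cosetE; exists (val (base ^@ x^-1%g).1) => //=.
  by exists (pow k) => //; rewrite cosetE (pow_coset k ltk).
apply: inj_card_eq => k l /[!inE] ltk ltl eqkl.
have := pow_coset k ltk; rewrite eqkl => <-.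
by rewrite (pow_coset k ltk).
Qed.

(** * The positive cone and its rank *)

Definition cone : set (Gamma n) :=
  [set g | stab g /\ exists2 w, w != [::] & g = ev n w].

Lemma cone_mul : mulg_closed [in cone].
Proof.
move=> g h /[!inE] -[gH [u u0 gE]] [hH [v v0 hE]]; split.
  exact/stabM.
exists (u ++ v); last by rewrite ev_cat gE hE.
by case: (u) u0.
Qed.

Lemma cone_positive : positive_cone stab cone.
Proof.
have n_gt0 : (0 < n)%N by have := dvdn_leq (ltn0Sn n) dvd_n1; lia.
have not1 (u v : seq bool) : u != [::] -> (ev n u * ev n v)%g != 1%g.
  move=> u0; rewrite -ev_cat; apply/eqP => /(ev_eq1 n_gt0).
  by case: (u) u0.
split.
- by move=> g [].
- exact: cone_mul.
- apply/seteqP; split=> [g gH|g].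
    have [w gE] := ev_or_inv g.
    have [w0|w0] := eqVneq w [::].
      by right; case: gE; rewrite /= w0 ev_nil ?invg1.
    left; case: gE => gE; [left | right].
      by split=> //; exists w.
    exists g^-1%g; last exact: invgK.
    by split; [exact: stabV | exists w => //; rewrite gE invgK].
  move=> [[[]//|[h [hH _] <-]]|->]; [exact: stabV | exact: stab1].
- have coneV g : cone g -> ~ cone g^-1%g.
    move=> [_ [u u0 gE]] [_ [v _ gVE]]; have := not1 u v u0.
    by rewrite -gE -gVE mulgV eqxx.
  have cone1 : ~ cone 1%g by move=> c1; apply: (coneV _ c1); rewrite invg1.
  split; apply/seteqP; split=> // g [].
  + by move=> gP [h hP hE]; apply: (coneV _ hP); rewrite hE.
  + by move=> gP /= g1; apply: cone1; rewrite -g1.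
  + by move=> [h hP <-] /= h1; apply: cone1; rewrite -(invg1 (Gamma n)) -h1 invgK.
Qed.

Definition block_gens : set (Gamma n) :=
  [set ev n (nseq i false ++ nseq (p.+1 - i) true) | i in `I_p.+2].

Lemma semigroup_gen_mul (S : set (Gamma n)) g h :
  semigroup_gen S g -> semigroup_gen S h -> semigroup_gen S (g * h)%g.
Proof.
move=> gS hS M [Mmul SM]; apply/set_mem/Mmul; apply/mem_set.
  exact: gS.
exact: hS.
Qed.

Lemma cone_generated : semigroup_gen block_gens = cone.
Proof.
apply/seteqP; split.
  apply: smallest_sub; first exact: cone_mul.
  move=> _ [i /= lei <-].
  have size_m : size (nseq i false ++ nseq (p.+1 - i) true) = p.+1.
    by rewrite size_cat !size_nseq subnKC.
  split; first by apply/stab_ev; rewrite size_m.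
  by exists (nseq i false ++ nseq (p.+1 - i) true); rewrite // -size_eq0 size_m.
move=> _ [/[swap] -[w w0 ->] /stab_ev/dvdnP[c size_w]].
have [t n1E] : exists t, n.+1 = (p.+1 * t.+1)%N.
  have /dvdnP[[|k] kE] := dvd_n1; first by [].
  by exists (k.*2.+1); rewrite kE; lia.
case: c size_w => [/size0nil w0'|c size_w]; first by rewrite w0' in w0.
apply: (block_words n1E (@semigroup_gen_mul _) _ (c := c)); last first.
  by rewrite size_w mulnC.
by move=> i lei; apply: sub_gen_smallest; exists i.
Qed.

(** The words a^m and a^x (b a^n) a^(m-x) are in the cone and their images are
    e_0 and e_(x+1) + e_0, which span the whole space. *)
Lemma nu_cone_span r (M : 'M['F_2]_(r, p.+2)) :
  (forall g, cone g -> (nu g <= M)%MS) -> (p.+2 <= r)%N.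
Proof.
move=> nuM_sub.
have nu_pos u g : g = ev n u -> nu g = (act_pos schreier_action base u).2.
  by move=> ->; rewrite /nu act_ev.
have e0M : (e_ ord0 <= M)%MS.
  have -> : e_ ord0 = nu (ev n (nseq p.+1 false)).
    rewrite (nu_pos _ _ erefl) act_pos_nseq (iter_advance _ _).2 add0r.
    by rewrite divnn scale1r.
  apply: nuM_sub; split; last by exists (nseq p.+1 false).
  by apply/stab_ev; rewrite size_nseq.
have eM (x : 'I_p.+1) : (e_ (lift ord0 x) <= M)%MS.
  pose w := nseq x false ++ (true :: nseq n false) ++ nseq (p.+1 - x) false.
  have nu_w : nu (ev n w) = e_ (lift ord0 x) + e_ ord0.
    rewrite (nu_pos _ _ erefl) !act_pos_cat /= !act_pos_nseq -iterSr.
    rewrite [alpha _]/= iter_advance_full.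
    have [] := iter_advance x base; rewrite /base /= add0n divn_small // modn_small //.
    rewrite scale0r add0r; case: (iter _ _ _) => [y v] /= /val_inj -> ->.
    rewrite (iter_advance _ _).2 /= subnKC ?divnn ?scale1r ?add0r //.
    exact: ltnW.
  have -> : e_ (lift ord0 x) = nu (ev n w) - e_ ord0 by rewrite nu_w addrK.
  rewrite addmx_sub ?eqmx_opp //; apply: nuM_sub; split.
    apply/stab_ev; rewrite !size_cat /= !size_nseq.
    have ltx := ltn_ord x; have := dvdn_trans (dvdn_mull 2 (dvdnn p.+1)) dvd_n1.
    by move=> dvd; rewrite addnCA subnKC 1?ltnW // dvdn_addl.
  by exists w => //; rewrite /w; case: (nseq x false).
have : (1%:M <= M)%MS.
  apply/row_subP => i; rewrite rowE mulmx1.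
  by case: (unliftP ord0 i) => [x|] ->.
by move/mxrankS; rewrite mxrank1 => /leq_trans; apply; exact: rank_leq_row.
Qed.

(** For a finite generating set take its images as the rows of a matrix: the
    elements of H whose image lies in the row space form a semigroup, so this
    row space contains the images of the whole cone. *)
Lemma cone_rank : semigroup_rank cone p.+2.
Proof.
have lower (S : set (Gamma n)) : semigroup_gen S = cone -> (`I_p.+2 #<= S)%card.
  move=> SE; have [finS|/infiniteP infS] := pselect (finite_set S); last first.
    exact/(card_le_trans _ infS)/subset_card_le.
  have [r /card_eqPle[S_le_r r_le_S]] := (finite_setP S).1 finS.
  apply: card_le_trans r_le_S; rewrite card_le_II.
  have [f fS] : exists f : nat -> Gamma n,
      forall g, S g -> exists2 i, (i < r)%N & f i = g.
    case/pfcard_geP: S_le_r => [->|[f]]; first by exists (fun=> 1%g).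
    by exists f => g /(@surj _ _ _ _ f).
  pose M : 'M['F_2]_(r, p.+2) := \matrix_(i < r) nu (f i).
  apply: (@nu_cone_span r M) => g gC.
  suff : stab g /\ (nu g <= M)%MS by case.
  move: g gC; rewrite -SE; apply: smallest_sub.
    move=> g h /[!inE] -[gH gM] [hH hM]; split; first exact/stabM.
    by rewrite nuM // addmx_sub.
  move=> g gS; split.
    suff : cone g by case.
    by rewrite -SE; apply: sub_gen_smallest.
  have [i ltir <-] := fS g gS.
  rewrite -[f i](_ : f (Ordinal ltir) = _) //.
  by rewrite -(rowK (fun k : 'I_r => nu (f k))) row_sub.
split; last exact: lower.
exists block_gens; last exact: cone_generated.
apply/card_eqPle; split; first exact: card_image_le.
exact/lower/cone_generated.
Qed.

End Stabilizer.

Theorem theorem1p2 (m n : nat) (hm : (2 <= m)%N) (hn : (2 <= n)%N)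
    (hmn : exists2 t : int, odd (absz t) &
       (n%:Z = m%:Z - 1 + m%:Z * t)%R) :
  exists H : set (Gamma n),
    [/\ group_closed [in H],
        has_index H m &
        exists2 P : set (Gamma n), positive_cone H P & semigroup_rank P m.+1].
Proof.
case: m hm hmn => [//|p] _ [t odd_t nE].
have dvd_n1 : 2 * p.+1 %| n.+1.
  case: t odd_t nE => t odd_t nE; last by nia.
  (* n + 1 = m (t + 1) with t + 1 even *)
  have -> : n.+1 = p.+1 * t.+1 by lia.
  by rewrite mulnC dvdn_pmul2l // dvdn2 /= negbK.
exists (stab dvd_n1); split; [exact: stab_group | exact: stab_index |].
by exists (cone dvd_n1); [exact: cone_positive | exact: cone_rank].
Qed.
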